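(* Let $f \colon A^n \to B$, and assume that $n > |A|$ and $f$ is determined by $\operatorname{supp}$. Then the function $f$ is reconstructible.
   Context: $A$ and $B$ are sets with at least two elements; $n$ is a positive integer. $[n] := \{1,\dots,n\}$, $\binom{[n]}{2}$ denotes the set of all $2$-element subsets of $[n]$, and $\Sigma_n$ is the symmetric group on $[n]$. For $\mathbf{a} \in A^n$ and $\sigma \colon [m] \to [n]$, write $\mathbf{a}\sigma := (a_{\sigma(1)},\dots,a_{\sigma(m)}) \in A^m$. Functions $f, g \colon A^n \to B$ are equivalent, $f \equiv g$, if there is $\sigma \in \Sigma_n$ with $f(\mathbf{a}) = g(\mathbf{a}\sigma)$ for all $\mathbf{a} \in A^n$. For $n \geq 2$, $f \colon A^n \to B$ and $I \in \binom{[n]}{2}$, the identification minor $f_I \colon A^{n-1} \to B$ is given by $f_I(\mathbf{a}) = f(\mathbf{a}\delta_I)$, where $\delta_I \colon [n] \to [n-1]$ is defined by $\delta_I(i) = i$ if $i < \max I$, $\delta_I(i) = \min I$ if $i = \max I$, and $\delta_I(i) = i-1$ if $i > \max I$. The deck of $f$, $\operatorname{deck} f$, is the multiset $\{f_I/{\equiv} : I \in \binom{[n]}{2}\}$ of equivalence classes. A function $g \colon A^n \to B$ is a reconstruction of $f$ if $\operatorname{deck} f = \operatorname{deck} g$. The function $f$ is reconstructible if it is equivalent to all of its reconstructions. $\mathcal{P}(A)$ is the power set of $A$ and $\operatorname{supp}(a_1,\dots,a_n) := \{a_1,\dots,a_n\}$. A function $f \colon A^n \to B$ is determined by $\operatorname{supp}$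 if there exists $f^* \colon \mathcal{P}(A) \to B$ such that $f = f^* \circ \operatorname{supp}|_{A^n}$. *)

(* Defs.v *)
From HB Require Import structures.
From mathcomp Require Import all_boot perm.
From mathcomp Require Import finmap multiset boolp classical_sets.

Set Implicit Arguments.
Unset Strict Implicit.
Unset Printing Implicit Defensive.

Local Open Scope nat_scope.

(* [n] is modelled by 'I_n = {0, ..., n-1}, and A ^ n is {ffun 'I_n -> A}.
   The alphabet A is a finType because the hypothesis |A| < n forces A to be
   finite; B is an arbitrary type. *)

Definition subst_coord (A : Type) (m n : nat) (a : A ^ n) (s : 'I_m -> 'I_n) :
  A ^ m := [ffun i => a (s i)].

Definition equivalent (A B : Type) (n : nat) (f g : A ^ n -> B) : Prop :=
  exists s : {perm 'I_n}, forall a : A ^ n, f a = g (subst_coord a s).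

Definition pairs (n : nat) : Type := {I : {set 'I_n} | #|I| == 2}.
HB.instance Definition _ (n : nat) := Finite.on (pairs n).

Definition maxI (n : nat) (I : {set 'I_n}) : nat := \max_(i in I) i.

(* The default value n is never reached on a nonempty I. *)
Definition minI (n : nat) (I : {set 'I_n}) : nat := \big[minn/n]_(i in I) i.

Definition delta_nat (n : nat) (I : {set 'I_n}) (i : nat) : nat :=
  if i < maxI I then i
  else if i == maxI I then minI I
  else i.-1.

Lemma minI_le (n : nat) (I : {set 'I_n}) (i : 'I_n) : i \in I -> minI I <= i.
Proof.
rewrite /minI; elim: index_enum (mem_index_enum i) => // j r IHr.
rewrite inE big_cons => /predU1P[<- -> | ri Ii]; first exact: geq_minl.
by case: ifP => _; rewrite ?geq_min ?IHr ?orbT.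
Qed.

Lemma maxI_lt (n : nat) (I : {set 'I_n}) (i : 'I_n) : maxI I < n.
Proof.
by apply/(big_ind (fun m => m < n)) => [|x y|j _] //;
  [exact: leq_ltn_trans (ltn_ord i) | rewrite gtn_max => -> ->].
Qed.

Lemma minI_lt_maxI (n : nat) (I : pairs n) : minI (val I) < maxI (val I).
Proof.
have /cards2P[x [y [nxy ->]]] := valP I.
have le_max z : z \in [set x; y] -> z <= maxI [set x; y].
  by move=> zI; exact: (leq_bigmax_cond (F := fun i : 'I_n => i : nat)).
have xI : x \in [set x; y] by rewrite !inE eqxx.
have yI : y \in [set x; y] by rewrite !inE eqxx orbT.
have [lt_xy|lt_yx|/val_inj e_xy] := ltngtP x y.
- exact: leq_ltn_trans (minI_le xI) (leq_trans lt_xy (le_max _ yI)).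
- exact: leq_ltn_trans (minI_le yI) (leq_trans lt_yx (le_max _ xI)).
- by rewrite e_xy eqxx in nxy.
Qed.

Lemma delta_subproof (n : nat) (I : pairs n) (i : 'I_n) :
  delta_nat (val I) i < n.-1.
Proof.
have lt_in := ltn_ord i.
have lt_Mn := maxI_lt (val I) i.
have lt_mM := minI_lt_maxI I.
have n_gt0 : 0 < n := leq_ltn_trans (leq0n _) lt_in.
have le_Mn : maxI (val I) <= n.-1 by rewrite -ltnS prednK.
rewrite /delta_nat; case: (ltngtP i) => [lt_iM|lt_Mi|_].
- exact: leq_trans lt_iM le_Mn.
- have i_gt0 : 0 < i := leq_ltn_trans (leq0n _) lt_Mi.
  by rewrite -ltnS !prednK.
- exact: leq_trans lt_mM le_Mn.
Qed.

Definition delta (n : nat) (I : pairs n) (i : 'I_n) : 'I_n.-1 :=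
  Ordinal (delta_subproof I i).

Definition minor (A B : Type) (n : nat) (f : A ^ n -> B) (I : pairs n) :
  A ^ n.-1 -> B := fun a => f (subst_coord a (delta I)).

Definition eqv_class (A B : Type) (n : nat) (f : A ^ n -> B) :
  set (A ^ n -> B) := [set g | equivalent f g]%classic.

Definition deck (A B : Type) (n : nat) (f : A ^ n -> B) :
  {mset set (A ^ n.-1 -> B)}%mset :=
  seq_mset [seq eqv_class (minor f J) | J <- enum {: pairs n}].

Definition reconstruction (A B : Type) (n : nat) (f g : A ^ n -> B) : Prop :=
  deck f = deck g.

Definition reconstructible (A B : Type) (n : nat) (f : A ^ n -> B) : Prop :=
  forall g : A ^ n -> B, reconstruction f g -> equivalent f g.

Definition supp (A : finType) (n : nat) (a : A ^ n) : {set A} :=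
  [set a i | i : 'I_n].

Definition determined_by_supp (A : finType) (B : Type) (n : nat)
  (f : A ^ n -> B) : Prop :=
  exists fstar : {set A} -> B, forall a : A ^ n, f a = fstar (supp a).

(* Main.v *)
(** Every minor of [f] is one and the same fully symmetric function
    [h = f* o supp], so every minor of a reconstruction [g] equals [h] on the
    nose. Since |A| < n, each tuple has a repeated entry and hence is of the
    form [a delta_I] with [a] of the same support, which forces [g = f]. *)
Require Import Defs.
From mathcomp Require Import all_boot.
From mathcomp Require Import perm multiset.

Set Implicit Arguments.
Unset Strict Implicit.
Unset Printing Implicit Defensive.

Lemma maxI_set2 (n : nat) (i j : 'I_n) : i < j -> maxI [set i; j] = j.
Proof.
move=> lt_ij; rewrite /maxI big_setU1 ?inE -?val_eqE ?neq_ltn ?lt_ij //=.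
by rewrite big_set1; apply/maxn_idPr/ltnW.
Qed.

Lemma minI_set2 (n : nat) (i j : 'I_n) : i < j -> minI [set i; j] = i.
Proof.
move=> lt_ij; apply/eqP; rewrite eqn_leq minI_le ?set21 //=.
apply: (big_ind (fun m => i <= m)) => [|x y ix iy|k].
- exact: ltnW.
- by rewrite leq_min ix.
- by rewrite !inE => /orP[]/eqP-> //; exact: ltnW.
Qed.

Lemma pairs_ltP (n : nat) (I : pairs n) :
  exists i j : 'I_n, i < j /\ val I = [set i; j].
Proof.
have /cards2P[i [j [neq_ij ->]]] := valP I.
move: neq_ij; rewrite -val_eqE neq_ltn => /orP[lt_ij|lt_ji].
  by exists i, j.
by exists j, i; rewrite setUC.
Qed.

(** [lift j] skips exactly the position [j] that [delta I] merges into [i]; hence it is a section of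
    [delta I], which is therefore surjective. *)
Lemma delta_lift (n : nat) (i j : 'I_n) (I : pairs n) :
  i < j -> val I = [set i; j] -> cancel (lift j) (delta I).
Proof.
move=> lt_ij defI k; apply: val_inj => /=.
rewrite /delta_nat defI maxI_set2 // minI_set2 //= /bump.
case: (leqP j k) => [le_jk|lt_kj]; last by rewrite lt_kj.
by rewrite add1n ltnNge leqW //= gtn_eqF.
Qed.

(** The composite in the other order is the retraction collapsing [j] onto [i]; it fixes every tuple
    whose entries at [i] and [j] agree. *)
Lemma lift_delta (n : nat) (i j : 'I_n) (I : pairs n) (k : 'I_n) :
  i < j -> val I = [set i; j] ->
  lift j (delta I k) = if k == j then i else k.
Proof.
move=> lt_ij defI; apply: val_inj; rewrite /= /delta_nat defI.
rewrite maxI_set2 // minI_set2 // -val_eqE /bump.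
case: (ltngtP k j) => [lt_kj|lt_jk|_] /=.
- by rewrite leqNgt lt_kj.
- by case: (nat_of_ord k) lt_jk => // m; rewrite ltnS => /= ->.
- by rewrite leqNgt lt_ij.
Qed.

(** The section [t] witnesses that [s] is onto, so no entry of [a] is lost. This covers both
    [delta I] and permutations. *)
Lemma supp_subst_coord (A : finType) (m n : nat) (a : A ^ n)
  (s : 'I_m -> 'I_n) (t : 'I_n -> 'I_m) :
  cancel t s -> supp (subst_coord a s) = supp a.
Proof.
move=> tK; apply/setP=> x.
apply/imsetP/imsetP => -[i _ ->]; first by exists (s i); rewrite ?ffunE.
by exists (t i); rewrite ?ffunE ?tK.
Qed.

Lemma supp_subst_delta (A : finType) (n : nat) (I : pairs n) (a : A ^ n.-1) :
  supp (subst_coord a (delta I)) = supp a.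
Proof.
have [i [j [lt_ij defI]]] := pairs_ltP I.
exact: supp_subst_coord (delta_lift lt_ij defI).
Qed.

Lemma subst_coord_delta_surj (A : finType) (n : nat) (b : A ^ n) :
  #|A| < n ->
  exists (I : pairs n) (a : A ^ n.-1), b = subst_coord a (delta I).
Proof.
move=> ltAn.
have /injectivePn[x [y neq_xy bxy]] : ~~ injectiveb b.
  by apply/injectiveP => /leq_card; rewrite card_ord leqNgt ltAn.
have card_xy : #|[set x; y]| == 2 by rewrite cards2 neq_xy.
pose I : pairs n := exist _ [set x; y] card_xy.
have [i [j [lt_ij defI]]] := pairs_ltP I.
(* The collision [x], [y] comes unordered, while [i < j] is the same pair sorted. *)
have bij : b i = b j.
  have constb k : k \in [set x; y] -> b k = b x.
    by rewrite !inE => /orP[]/eqP->; rewrite -?bxy.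
  by rewrite !constb // -[[set x; y]]/(val I) defI !inE eqxx ?orbT.
(* Delete entry [j]; [delta I] restores it as a copy of entry [i]. *)
exists I, (subst_coord b (lift j)); apply/ffunP=> k; rewrite !ffunE.
by rewrite (lift_delta k lt_ij defI); case: eqP => [->|].
Qed.

Lemma subst_coord1 (A : Type) (n : nat) (a : A ^ n) :
  subst_coord a (1%g : {perm 'I_n}) = a.
Proof. by apply/ffunP=> i; rewrite ffunE perm1. Qed.

Lemma equivalent_refl (A B : Type) (n : nat) (f : A ^ n -> B) :
  equivalent f f.
Proof. by exists 1%g => a; rewrite subst_coord1. Qed.

Lemma deck_eq_minor (A B : Type) (n : nat) (f g : A ^ n -> B) (J : pairs n) :
  deck f = deck g -> exists I : pairs n, equivalent (minor f I) (minor g J).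
Proof.
move=> /eq_seq_msetP/perm_mem/(_ (eqv_class (minor g J))).
rewrite [RHS]map_f ?mem_enum // => /mapP[I _ eq_class]; exists I.
(* Equal classes give equivalence, since [minor g J] lies in its own class. *)
change (eqv_class (minor f I) (minor g J)); rewrite -eq_class.
exact: equivalent_refl.
Qed.

Theorem proposition3p10 (A : finType) (B : Type) (n : nat)
  (hA : 2 <= #|A|) (hB : exists b1 b2 : B, b1 <> b2)
  (f : A ^ n -> B) (hn : #|A| < n) (hf : determined_by_supp f) :
  reconstructible f.
Proof.
have [fstar fE] := hf => g eq_deck; exists 1%g => b.
rewrite subst_coord1.
have [J [a ->]] := subst_coord_delta_surj b hn.
have [I [s minorE]] := deck_eq_minor J eq_deck.
(* [minorE] evaluates [minor g J] at tuples permuted by [s], so [a] is first written in that form.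
   Both sides then reduce to [fstar (supp c)]. *)
pose c := subst_coord a (s^-1)%g.
have -> : a = subst_coord c s by apply/ffunP=> i; rewrite !ffunE permK.
rewrite -[RHS]/(minor g J _) -minorE /minor !fE !supp_subst_delta.
by rewrite (supp_subst_coord _ (permKV s)).
Qed.
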